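(* In the setting of the context (a weighted genus two admissible cover over the standard log point, with associated function $\lambda$), suppose that $\Delta^\circ=\{\lambda>0\}$ is connected of genus two. If there is only one vertex of positive weight on the boundary of $\Delta_T^\circ=\{\lambda_T>0\}\subseteq\Gamma_T$, then it is the special one, i.e. it is the vertex supporting the divisor $D$.
   Context: *Admissible cover.* Over $\mathbb C$, let $\psi\colon(C,D_R)\to(T,D_B)$ be a hyperelliptic admissible cover: a finite degree two morphism of nodal curves, $C$ connected of arithmetic genus $2$, $T$ of genus $0$, étale on $C^{sm}\setminus D_R$, simply ramified along the six smooth points $D_R$ mapping to six distinct smooth points $D_B$, mapping nodes to nodes with the same ramification order $1$ or $2$ on both branches. It carries a weight $w\colon V(\Gamma)\to\mathbb N$ on the dual graph of $C$, not identically zero, such that with $w_T(v)=\sum_{v'\mapsto v}w(v')$ (the weight of a vertex of $\Gamma_T$) every component of $T$ with $w_T=0$ has at least three nodes or branch points. *Metric.* $\Gamma=\mathrm{trop}(C)$ and the tree $\Gamma_T=\mathrm{trop}(T)$ are the dual graphs with positive real edge lengths, where the length of an edge of $\Gamma_T$ is the ramification order (expansion factor) times the length of any edge of $\Gamma$ above it; $\mathrm{trop}(\psi)\colon\Gamma\to\Gamma_T$ is the induced harmonic map of degree two. For a subcurve, genus means arithmetic genus: first Betti number plus sum of vertex genera. *Functions.* A piecewise linear (PL) function has integral slopes on (a subdivision of) $\Gamma$ (half-integral slopes allowed on $\Gamma_T$); $\mathrm{div}(\lambda)(v)$ is the sum of outgoing slopes at $v$; $K_\Gamma(v)=2g(v)-2+\mathrm{val}(v)$.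 Pullback along $\mathrm{trop}(\psi)$ composes functions and multiplies divisors by local degrees. On $\Gamma_T$ let $D'(v)=\mathrm{val}(v)-2+\tfrac12\deg(D_B|_v)$ (valence counts edges only); it has degree $1$ and pulls back to $K_\Gamma$. For each vertex $v_0$ of $\Gamma_T$ there is a PL function $\overline\lambda_T$, unique up to constants, with $D'+\mathrm{div}(\overline\lambda_T)=v_0$; its pullback to $\Gamma$ is an *admissible function*. Let $\overline\lambda_1,\dots,\overline\lambda_s$ be all of them and let $\lambda_i$ be $\overline\lambda_i$ shifted by a constant so that vertices with $\lambda_i>0$ have weight $0$ while those with $\lambda_i\ge0$ have total weight $\ge1$ (i.e. the maximum of $\lambda_i$ on vertices of positive weight is $0$). Define $\lambda=\max\{0,\lambda_1,\dots,\lambda_s\}$, a PL function on a subdivision of $\Gamma$, pulled back from $\lambda_T$ on $\Gamma_T$. Put $\Delta^\circ=\{\lambda>0\}$ and let $\Delta$ be the minimal subcurve of genus two containing the closure of $\Delta^\circ$, $\Delta_T$ its image in $\Gamma_T$. With $D'$ computed using valences in $\Delta_T$, $D=D'+\mathrm{div}(\lambda_T)$ is an effective divisor of degree $1$ with half-integral coefficients on $\Delta_T$ and $\mathrm{trop}(\psi)^*D=K_\Delta+\mathrm{div}(\lambda)$ on $\Delta$. The point(s) supporting $D$ are called special.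
   Formalization: In D' on Δ_T the branch divisor is that of the restricted cover Δ→Δ_T: each ramified node cut at the boundary of Δ_T adds 1/2. With D_B alone, D can have a coefficient −1/2 at a boundary point, so it is not effective of degree 1 and the claim fails. *)

(* Defs.v *)
From HB Require Import structures.
From mathcomp Require Import all_boot all_order all_algebra.
From mathcomp Require Import reals ring lra zify.

Set Implicit Arguments.
Unset Strict Implicit.
Unset Printing Implicit Defensive.

Import Order.TTheory GRing.Theory Num.Theory.
Local Open Scope ring_scope.

(* Admissible covers enter through their dual graphs: the functions, divisors,
   weights and subcurves all live on them, and every datum satisfying
   is_double_cover below is the dual graph of an admissible cover over C. *)

(** * Finite metric graphs *)

(* Each edge carries an arbitrary auxiliary orientation src -> tgt. *)
Record mgraph (R : realType) := MGraph {
  vert : finType;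
  edge : finType;
  src : edge -> vert;
  tgt : edge -> vert;
  len : edge -> R
}.

Section Graph.
Variables (R : realType) (G : mgraph R).
Implicit Types (S : {set vert G}) (f : vert G -> R) (g : vert G -> nat).

(* The half-edge (e, false) starts at src e, the half-edge (e, true) at tgt e. *)
Definition hstart (h : edge G * bool) : vert G :=
  if h.2 then tgt h.1 else src h.1.

Definition hend (h : edge G * bool) : vert G :=
  if h.2 then src h.1 else tgt h.1.

(* A subcurve is a union of components together with all the nodes joining
   them: it is given by a set S of vertices, and its dual graph is the subgraph
   induced on S. *)
Definition adj_in S : rel (vert G) :=
  [rel x y | [&& x \in S, y \in S
               & [exists h, (hstart h == x) && (hend h == y)]]].

Definition ncomp S : nat := n_comp (adj_in S) S.

Definition subcurve_connected S : bool := ncomp S == 1%N.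

Definition edges_in S : {set edge G} :=
  [set e | (src e \in S) && (tgt e \in S)].

(* The subtraction is never truncated. *)
Definition betti1 S : nat := (#|edges_in S| + ncomp S - #|S|)%N.

Definition genus g S : nat := (betti1 S + \sum_(v in S) g v)%N.

(* The valence of v in the subcurve S. *)
Definition val_in S v : nat := #|[set h | (hstart h == v) && (hend h \in S)]|.

(* A function on vertices stands for its extension that is affine on edges. *)
Definition slope f (h : edge G * bool) : R :=
  (f (hend h) - f (hstart h)) / len h.1.

(* The divisor, on the subcurve S, of the restriction of f to S. *)
Definition div_in S f v : R :=
  \sum_(h | (hstart h == v) && (hend h \in S)) slope f h.

Definition on_edge f (e : edge G) (t : R) : R :=
  f (src e) + (f (tgt e) - f (src e)) * (t / len e).

Definition canonical_in g S v : R := 2 * (g v)%:R - 2 + (val_in S v)%:R.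

End Graph.

(** * Double covers of trees *)

(* The dual graphs of psi : (C, D_R) -> (T, D_B) with the local degrees of
   trop(psi), i.e. the degrees of psi on the components of C and its
   ramification orders at the nodes of C. The six points of D_R are numbered,
   and ramv i is the component carrying the i-th one; D_B is their image. *)
Record double_cover (R : realType) := DoubleCover {
  Gam : mgraph R;
  GamT : mgraph R;
  vgen : vert Gam -> nat;
  psiV : vert Gam -> vert GamT;
  psiE : edge Gam -> edge GamT;
  degV : vert Gam -> nat;
  degE : edge Gam -> nat;
  ramv : 'I_6 -> vert Gam;
  wt : vert Gam -> nat
}.

Section Cover.
Variables (R : realType) (X : double_cover R).

Definition psiH (h : edge (Gam X) * bool) : edge (GamT X) * bool :=
  (psiE h.1, h.2).

Definition wtT (v : vert (GamT X)) : nat :=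
  (\sum_(x | psiV x == v) wt x)%N.

Definition ramdeg (x : vert (Gam X)) : nat := #|[set i | ramv X i == x]|.

Definition branchdeg (v : vert (GamT X)) : nat :=
  #|[set i | psiV (ramv X i) == v]|.

(* The node of T given by e is a branch point of psi. *)
Definition ramified (e : edge (GamT X)) : bool :=
  [exists e', (psiE e' == e) && (degE e' == 2%N)].

(* The combinatorial conditions satisfied by the dual graphs of a hyperelliptic
   admissible cover of genus two; riemann_hurwitz, applied to each component of
   C, expresses that psi is unramified away from D_R and the nodes. *)
Record is_double_cover : Prop := IsDoubleCover {
  Gam_connected : subcurve_connected [set: vert (Gam X)];
  Gam_genus : genus (@vgen R X) [set: vert (Gam X)] = 2%N;
  GamT_connected : subcurve_connected [set: vert (GamT X)];
  GamT_tree : betti1 [set: vert (GamT X)] = 0%N;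
  psi_src : forall e : edge (Gam X), psiV (src e) = src (psiE e);
  psi_tgt : forall e : edge (Gam X), psiV (tgt e) = tgt (psiE e);
  len_gt0 : forall e : edge (Gam X), 0 < len e;
  lenT_gt0 : forall e : edge (GamT X), 0 < len e;
  degE12 : forall e : edge (Gam X), (degE e == 1%N) || (degE e == 2%N);
  len_psi : forall e : edge (Gam X), len (psiE e) = (degE e)%:R * len e;
  degV_gt0 : forall x : vert (Gam X), (0 < degV x)%N;
  degree2 : forall v : vert (GamT X), (\sum_(x | psiV x == v) degV x = 2)%N;
  harmonic : forall (x : vert (Gam X)) (k : edge (GamT X) * bool),
    hstart k = psiV x ->
    (\sum_(h | (hstart h == x) && (psiH h == k)) degE h.1 = degV x)%N;
  simply_ramified : forall i, degV (ramv X i) = 2%N;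
  riemann_hurwitz : forall x : vert (Gam X),
    (2 * vgen x + 2 * degV x =
     2 + (ramdeg x + \sum_(h | hstart h == x) (degE h.1).-1))%N
}.

Record is_weighted_cover : Prop := IsWeightedCover {
  weighted_double_cover : is_double_cover;
  weight_neq0 : exists x : vert (Gam X), (0 < wt x)%N;
  weight_stable : forall v : vert (GamT X), wtT v = 0%N ->
    (3 <= val_in [set: vert (GamT X)] v + branchdeg v)%N
}.

(** * The divisor D' and admissible functions *)

(* The degree at v of the branch divisor of the cover restricted to the
   subcurve S of T: when T is cut along a ramified node, the ramification at
   that node becomes a smooth branch point of the restricted cover. Without
   these points the divisor D below would neither have degree 1 nor satisfy
   pullback_D; for S = setT there are none. *)
Definition branchdeg_in (S : {set vert (GamT X)}) (v : vert (GamT X)) : nat :=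
  (branchdeg v +
   #|[set h | [&& hstart h == v, hend h \notin S & ramified h.1]]|)%N.

Definition D' (S : {set vert (GamT X)}) (v : vert (GamT X)) : R :=
  (val_in S v)%:R - 2 + (branchdeg_in S v)%:R / 2.

Record is_admissible (v0 : vert (GamT X)) (f : vert (GamT X) -> R) : Prop :=
  IsAdmissible {
  half_integral : forall h, exists k : int, 2 * slope f h = k%:~R;
  div_admissible : forall v,
    D' [set: vert (GamT X)] v + div_in [set: vert (GamT X)] f v = (v == v0)%:R
}.

(* This fixes the additive constant in an admissible function. *)
Record is_normalized (f : vert (GamT X) -> R) : Prop := IsNormalized {
  pos_wt0 : forall x : vert (Gam X), 0 < f (psiV x) -> wt x = 0%N;
  nneg_wt : (1 <= \sum_(x : vert (Gam X) | (0 <= f (psiV x))%R) wt x)%N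
}.

(* lambda_T = max {0, lambda_1, ..., lambda_s} at the point of the edge e at
   distance t from src e; there is one function lam v0 for each vertex v0. *)
Definition lambda_edge (lam : vert (GamT X) -> vert (GamT X) -> R)
    (e : edge (GamT X)) (t : R) : R :=
  \big[Num.max/0]_v0 on_edge (lam v0) e t.

Definition lambda_vert (lam : vert (GamT X) -> vert (GamT X) -> R)
    (v : vert (GamT X)) : R :=
  \big[Num.max/0]_v0 lam v0 v.

(** * The subcurves attached to a PL function on the target *)

(* f is a nonnegative function on the tree, affine on edges. *)
Variable f : vert (GamT X) -> R.

Definition pos_locusT : {set vert (GamT X)} := [set v | 0 < f v].

(* The open locus {f \o psi > 0} meets only edges with an end point in the
   following set of vertices, onto whose induced subgraph it retracts. *)
Definition pos_locus : {set vert (Gam X)} := [set x | 0 < f (psiV x)].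

Definition closure_of (G : mgraph R) (U : {set vert G}) : {set vert G} :=
  U :|: [set hend h | h in [set h | hstart h \in U]].

Definition boundaryT : {set vert (GamT X)} :=
  closure_of pos_locusT :\: pos_locusT.

Definition is_Delta (Delta : {set vert (Gam X)}) : bool :=
  minset (fun S => [&& closure_of pos_locus \subset S, subcurve_connected S
                     & genus (@vgen R X) S == 2%N]) Delta.

Definition D (S : {set vert (GamT X)}) (v : vert (GamT X)) : R :=
  D' S v + div_in S f v.

Definition special (S : {set vert (GamT X)}) : {set vert (GamT X)} :=
  [set v in S | D S v != 0].

End Cover.

Section Pullback.
Variables (R : realType) (X : double_cover R).
Hypothesis hX : is_double_cover X.

Lemma degV2_uniq (x y : vert (Gam X)) :
  psiV y = psiV x -> degV y = 2%N -> y = x.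
Proof.
move=> yx dy; apply/eqP; apply/negPn/negP => nyx.
have := degree2 hX (psiV x).
rewrite (bigD1 x) //= (bigD1 y) /=; last by rewrite yx eqxx nyx.
have := degV_gt0 hX x; lia.
Qed.

Lemma psi_hstart (h : edge (Gam X) * bool) :
  psiV (hstart h) = hstart (psiH h).
Proof. by case: h => e [] /=; rewrite /hstart /= ?(psi_tgt hX) ?(psi_src hX). Qed.

Lemma psi_hend (h : edge (Gam X) * bool) :
  psiV (hend h) = hend (psiH h).
Proof. by case: h => e [] /=; rewrite /hend /= ?(psi_tgt hX) ?(psi_src hX). Qed.

Lemma harmonic_sum (F : edge (GamT X) * bool -> R) (x : vert (Gam X)) :
  \sum_(h | hstart h == x) (degE h.1)%:R * F (psiH h) =
  (degV x)%:R * \sum_(k | hstart k == psiV x) F k.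
Proof.
rewrite (partition_big (@psiH R X) (fun k => hstart k == psiV x)) /=; last first.
  by move=> h /eqP <-; rewrite psi_hstart.
rewrite mulr_sumr; apply: eq_bigr => k /eqP kx.
rewrite -(harmonic hX kx) natr_sum mulr_suml.
by apply: eq_bigr => h /andP[_ /eqP ->].
Qed.

Lemma ramified_degE (h : edge (Gam X) * bool) :
  degE h.1 = if ramified (psiE h.1) then 2%N else 1%N.
Proof.
case: ifP => [/existsP[e /andP[/eqP ee /eqP d2]]|]; last first.
  move/existsP => nr; have /orP[/eqP//|d2] := degE12 hX h.1.
  by case: nr; exists h.1; rewrite eqxx d2.
have kh : psiH (e, h.2) = psiH h by rewrite /psiH /= ee.
have hs : hstart (psiH h) = psiV (hstart h) by rewrite psi_hstart.
pose y := hstart (e, h.2).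
have hy : hstart (psiH h) = psiV y by rewrite psi_hstart kh.
have dy : degV y = 2%N.
  have := harmonic hX hy; rewrite (bigD1 (e, h.2)) /=; last by rewrite kh !eqxx.
  rewrite d2 => Hy; have := degree2 hX (psiV y); rewrite (bigD1 y) //=; lia.
have yx : y = hstart h by apply: degV2_uniq => //; rewrite -hs hy.
have [->|ne] := eqVneq h (e, h.2); first by rewrite /= d2.
have := harmonic hX hy; rewrite (bigD1 (e, h.2)) /=; last by rewrite kh !eqxx.
rewrite (bigD1 h) /=; last by rewrite yx !eqxx ne.
by rewrite d2 dy; have /orP[/eqP->|/eqP->] := degE12 hX h.1.
Qed.

Lemma branch_ram (x : vert (Gam X)) :
  (2 * ramdeg x = degV x * branchdeg (psiV x))%N.
Proof.
have dx : degV x = 1%N \/ degV x = 2%N.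
  have := degree2 hX (psiV x); rewrite (bigD1 x) //=.
  have := degV_gt0 hX x; lia.
case: dx => dx.
  rewrite /ramdeg /branchdeg !eq_card0 ?muln0 // => i; rewrite !inE; apply/eqP.
    move=> ri; have := degV2_uniq ri (simply_ramified hX i).
    by move=> e; have := simply_ramified hX i; rewrite e dx.
  by move=> ri; have := simply_ramified hX i; rewrite ri dx.
rewrite dx; congr (2 * _)%N; apply: eq_card => i; rewrite !inE.
apply/eqP/eqP => [->//|ri]; exact: (degV2_uniq ri (simply_ramified hX i)).
Qed.

(* trop(psi)^* D = K_Delta + div(lambda), for Delta the preimage of S. *)
Lemma pullback_D (S : {set vert (GamT X)}) (f : vert (GamT X) -> R)
    (x : vert (Gam X)) :
  (degV x)%:R * D f S (psiV x) =
  canonical_in (@vgen R X) (@psiV R X @^-1: S) x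
    + div_in (@psiV R X @^-1: S) (f \o @psiV R X) x.
Proof.
have cardE (G : mgraph R) (P : pred (edge G * bool)) v :
    (#|[set h | (hstart h == v) && P h]|)%:R =
    \sum_(h | hstart h == v) (P h)%:R :> R.
  rewrite -sum1dep_card natr_sum big_mkcondr /=.
  by apply: eq_bigr => h _; case: (P h).
have divE : div_in (@psiV R X @^-1: S) (f \o @psiV R X) x =
    (degV x)%:R * div_in S f (psiV x).
  rewrite /div_in big_mkcondr [X in _ * X]big_mkcondr /= -harmonic_sum.
  apply: eq_bigr => h _; rewrite inE psi_hend.
  case: ifP => _; last by rewrite mulr0.
  rewrite /slope /= !psi_hend !psi_hstart (len_psi hX).
  have l0 := len_gt0 hX h.1; have d0 : (degE h.1)%:R != 0 :> R.
    by rewrite ramified_degE pnatr_eq0; case: ifP.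
  by field; rewrite d0 gt_eqF.
rewrite /D divE mulrDr; congr (_ + _).
rewrite /D' /branchdeg_in /canonical_in /val_in natrD !cardE.
have := riemann_hurwitz hX x => /(congr1 (fun n => n%:R : R)).
have := branch_ram x => /(congr1 (fun n => n%:R : R)).
rewrite !natrD !natrM natr_sum => bE rE.
have -> : 2 * (vgen x)%:R - 2 =
  (degV x)%:R * (branchdeg (psiV x))%:R / 2
  + \sum_(h | hstart h == x) ((degE h.1).-1)%:R - 2 * (degV x)%:R :> R by lra.
have -> : \sum_(h | hstart h == x) ((degE h.1).-1)%:R =
  \sum_(h | hstart h == x) (degE h.1)%:R * ((hend (psiH h) \in S)%:R
     + ((hend (psiH h) \notin S) && ramified (psiH h).1)%:R / 2)
  - \sum_(h | hstart h == x) (hend h \in @psiV R X @^-1: S)%:R :> R.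
  rewrite -sumrB; apply: eq_bigr => h _; rewrite inE psi_hend /=.
  rewrite ramified_degE; case: (_ \in S); case: ifP => _ /=; lra.
rewrite (harmonic_sum (fun k => (hend k \in S)%:R
     + ((hend k \notin S) && ramified k.1)%:R / 2)) big_split /= -mulr_suml.
ring.
Qed.
End Pullback.

(** * Subdivisions *)

(* The edge e is cut at the npts e points at distances
   cut e 1 < ... < cut e (npts e) from src e. *)
Record subdiv (R : realType) (G : mgraph R) := Subdiv {
  npts : edge G -> nat;
  cut : edge G -> nat -> R
}.

Record is_subdiv (R : realType) (G : mgraph R) (s : subdiv G) : Prop :=
  IsSubdiv {
  cut_first : forall e, cut s e 0 = 0;
  cut_last : forall e, cut s e (npts s e).+1 = len e;
  cut_lt : forall e i, (i <= npts s e)%N -> cut s e i < cut s e i.+1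
}.

Section Subdiv.
Variables (R : realType) (G : mgraph R) (s : subdiv G).

Definition sub_vert : finType := (vert G + {e : edge G & 'I_(npts s e)})%type.

Definition sub_edge : finType := {e : edge G & 'I_(npts s e).+1}.

(* The i-th point of the subdivided edge e, for 0 <= i <= npts s e + 1. *)
Definition sub_point (e : edge G) (i : nat) : sub_vert :=
  if i is j.+1 then
    if insub j is Some j' then inr (existT (fun e => 'I_(npts s e)) e j')
    else inl (tgt e)
  else inl (src e).

Definition sub_graph : mgraph R :=
  {| vert := sub_vert;
     edge := sub_edge;
     src := fun a : sub_edge => sub_point (tag a) (tagged a);
     tgt := fun a : sub_edge => sub_point (tag a) (tagged a).+1;
     len := fun a : sub_edge =>
              cut s (tag a) (tagged a).+1 - cut s (tag a) (tagged a) |}.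

End Subdiv.

Section SubCover.
Variables (R : realType) (X : double_cover R) (s : subdiv (GamT X)).

Definition sub_pull : subdiv (Gam X) :=
  {| npts := fun e => npts s (psiE e);
     cut := fun e i => cut s (psiE e) i / (degE e)%:R |}.

Definition on_orig (f : vert (Gam X) -> nat) (p : sub_vert sub_pull) : nat :=
  if p is inl x then f x else 0%N.

(* The new components of C have genus and weight 0. *)
Definition sub_cover : double_cover R :=
  {| Gam := sub_graph sub_pull;
     GamT := sub_graph s;
     vgen := on_orig (@vgen R X);
     psiV := fun p : sub_vert sub_pull =>
       match p return sub_vert s with
       | inl x => inl (psiV x)
       | inr q => inr (existT _ (psiE (tag q)) (tagged q))
       end;
     psiE := fun a : sub_edge sub_pull =>
       (existT _ (psiE (tag a)) (tagged a) : sub_edge s);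
     degV := fun p : sub_vert sub_pull =>
       match p with inl x => degV x | inr q => degE (tag q) end;
     degE := fun a : sub_edge sub_pull => degE (tag a);
     ramv := fun i => inl (ramv X i);
     wt := on_orig (@wt R X) |}.

Definition lambda_sub (lam : vert (GamT X) -> vert (GamT X) -> R)
    (p : vert (GamT sub_cover)) : R :=
  match p with
  | inl v => lambda_vert lam v
  | inr q => lambda_edge lam (tag q) (cut s (tag q) (tagged q).+1)
  end.

(* lambda_T is affine on every edge of the subdivision. *)
Definition adapted (lam : vert (GamT X) -> vert (GamT X) -> R) : Prop :=
  forall (e : edge (GamT X)) (i : nat), (i <= npts s e)%N ->
  exists a b : R, forall t : R, cut s e i <= t <= cut s e i.+1 ->
    lambda_edge lam e t = a + b * t.

End SubCover.

(* Main.v *)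
Require Import Defs.
From HB Require Import structures.
From mathcomp Require Import all_boot all_order all_algebra.
From mathcomp Require Import reals ring lra zify.

Set Implicit Arguments.
Unset Strict Implicit.
Unset Printing Implicit Defensive.

Import Order.TTheory GRing.Theory Num.Theory.
Local Open Scope ring_scope.

(* The genus of the preimage of a connected subcurve is read off its branch
   divisor (Riemann-Hurwitz), and is monotone on connected subcurves. Hence each
   branch of the tree hanging off the locus U = {lambda_T > 0}, whose preimage
   already has genus two, carries at most one branch point. Summing
   D' + div(lambda_i) over such a branch shows that every admissible function
   decreases strictly away from U; so its maximum 0 over the vertices of
   positive weight, which all lie outside U, is attained on the boundary of U,
   that is at v. As all the lambda_i vanish at v, the one with
   D' + div(lambda_i) = v is the largest by the minimum principle, lambda_T
   agrees with it on the closure of U, and D = v follows vertex by vertex. *)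

(** * Connected subgraphs *)

Section Connected.
Variables (R : realType) (G : mgraph R).
Implicit Types (S A : {set vert G}) (h : edge G * bool).

Definition hrev h : edge G * bool := (h.1, ~~ h.2).

Lemma hrevK : involutive hrev.
Proof. by case=> e b; rewrite /hrev /= negbK. Qed.

Lemma hstart_rev h : hstart (hrev h) = hend h.
Proof. by case: h => e []. Qed.

Lemma hend_rev h : hend (hrev h) = hstart h.
Proof. by case: h => e []. Qed.

Lemma half_edge_eq h k : k.1 = h.1 -> k = h \/ k = hrev h.
Proof.
by case: h k => [e b] [e' b'] /= ->; rewrite /hrev; case: b b' => -[]; auto.
Qed.

Lemma adj_in_sym S : symmetric (adj_in S).
Proof.
move=> x y; apply/and3P/and3P => -[xS yS /existsP[h /andP[hx hy]]]; split=> //;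
  by apply/existsP; exists (hrev h); rewrite hstart_rev hend_rev hx hy.
Qed.

Lemma adj_in_csym S : connect_sym (adj_in S).
Proof. exact/sym_connect_sym/adj_in_sym. Qed.

Definition closed_in S A :=
  forall h, hstart h \in A -> hend h \in S -> hend h \in A.

Lemma connect_invariant S A x y :
  closed_in S A -> x \in A -> connect (adj_in S) x y -> y \in A.
Proof.
move=> clA xA /connectP[p + ->]; elim: p x xA => //= z p IH x xA.
case/andP=> /and3P[xS zS /existsP[h /andP[/eqP hx /eqP hz]]]; apply: IH.
by rewrite -hz; apply: clA; rewrite ?hx ?hz.
Qed.

Lemma connected_sub S A x : subcurve_connected S -> x \in S -> x \in A ->
  closed_in S A -> S \subset A.
Proof.
move=> cS xS xA clA; apply/subsetP => y yS.
apply: (connect_invariant clA xA).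
have cl z : z \in S -> fingraph.root (adj_in S) z \in S.
  move=> zS; have /connectP[p + ->] := connect_root (adj_in S) z.
  elim: p z zS => //= t p IH z zS /andP[/and3P[_ tS _]]; exact: IH.
move: cS; rewrite /subcurve_connected /ncomp /n_comp_mem => /eqP/mem_card1[r rE].
have rt z : z \in S -> fingraph.root (adj_in S) z = r.
  move=> zS; apply/eqP; rewrite -[_ == _]/(_ \in pred1 r) -rE !inE cl //.
  by rewrite roots_root //; apply: adj_in_csym.
by rewrite -root_connect ?rt //; apply: adj_in_csym.
Qed.

Lemma connectedI S x : x \in S ->
  (forall A, x \in A -> closed_in S A -> S \subset A) -> subcurve_connected S.
Proof.
move=> xS sub; have csym := adj_in_csym S.
have /subsetP con : S \subset [set y | connect (adj_in S) x y].
  apply: sub => [|h]; first by rewrite inE.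
  rewrite !inE => xh hS; apply: (connect_trans xh); apply: connect1.
  have sS : hstart h \in S.
    have : closed_in S S by [].
    exact: (fun c => connect_invariant c xS xh).
  by apply/and3P; split=> //; apply/existsP; exists h; rewrite !eqxx.
rewrite /subcurve_connected /ncomp -(eq_n_comp_r (a := connect (adj_in S) x)).
  by rewrite n_comp_connect.
move=> y; apply/idP/idP => [xy|/con]; last by rewrite inE.
by have : closed_in S S by []; move/connect_invariant => /(_ _ _ xS xy).
Qed.

Lemma connected_neq0 S : subcurve_connected S -> exists x, x \in S.
Proof.
rewrite /subcurve_connected /ncomp /n_comp_mem => /eqP/mem_card1[r rE].
by exists r; have := rE r; rewrite !inE eqxx => /andP[].
Qed.

Lemma connected_exit S A x : subcurve_connected S -> A \subset S -> x \in A ->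
  A != S -> exists h, [/\ hstart h \in A, hend h \in S & hend h \notin A].
Proof.
move=> cS AS xA neq.
case: (pickP (fun h => [&& hstart h \in A, hend h \in S & hend h \notin A])).
  by move=> h /and3P[? ? ?]; exists h.
move=> no; case/negP: neq; rewrite eqEsubset AS.
apply: (connected_sub cS (subsetP AS _ xA) xA) => h hA hS.
by have := no h; rewrite hA hS /= => /negbFE.
Qed.

Lemma connected_setU1 S h : subcurve_connected S -> hstart h \in S ->
  subcurve_connected (hend h |: S).
Proof.
move=> cS hS; apply: (@connectedI _ (hstart h)) => [|A hA clA].
  by rewrite inE hS orbT.
have SA : S \subset A.
  by apply: (connected_sub cS hS hA) => k kA kS; apply: clA; rewrite // inE kS orbT.
by rewrite subUset sub1set SA andbT; apply: clA; rewrite // !inE eqxx.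
Qed.

Lemma edges_inS S A : S \subset A -> edges_in S \subset edges_in A.
Proof.
by move=> /subsetP SA; apply/subsetP => e; rewrite !inE => /andP[/SA-> /SA->].
Qed.

Lemma edges_in_half S h :
  (h.1 \in edges_in S) = (hstart h \in S) && (hend h \in S).
Proof. by case: h => e []; rewrite inE //= andbC. Qed.

Lemma card_edges_grow S A : subcurve_connected A -> S \subset A -> S != set0 ->
  (#|edges_in S| + #|A| <= #|edges_in A| + #|S|)%N.
Proof.
move=> cA; have [n] := ubnP (#|A| - #|S|); elim: n S => // n IH S ltn SA S0.
have [->//|neq] := eqVneq S A; have /set0Pn[x xS] := S0.
have [h [hS hA hnS]] := connected_exit cA SA xS neq.
have cS' : #|hend h |: S| = #|S|.+1 by rewrite cardsU1 hnS.
have SA' : hend h |: S \subset A by rewrite subUset sub1set hA.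
have ltSA : (#|S| < #|A|)%N.
  by rewrite proper_card // properEneq neq.
have S'0 : hend h |: S != set0 by apply/set0Pn; exists (hend h); rewrite setU11.
have ltE : (#|edges_in S| < #|edges_in (hend h |: S)|)%N.
  apply: proper_card; rewrite properE edges_inS ?subsetUr //=.
  apply/subsetPn; exists h.1; rewrite edges_in_half.
    by rewrite setU11 setU1r.
  by rewrite (negbTE hnS) andbF.
have := IH (hend h |: S) _ SA' S'0; rewrite cS' => /(_ ltac:(lia)); lia.
Qed.

Lemma card_connected S : subcurve_connected S -> (#|S| <= #|edges_in S|.+1)%N.
Proof.
move=> cS; have [x xS] := connected_neq0 cS.
have := card_edges_grow (S := [set x]) cS.
rewrite sub1set xS => /(_ isT); rewrite cards1 => H.
have : [set x] != set0 by apply/set0Pn; exists x; rewrite inE.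
by move/H; lia.
Qed.

Lemma genus_connected g S : subcurve_connected S ->
  (genus g S + #|S| = #|edges_in S| + 1 + \sum_(v in S) g v)%N.
Proof.
move=> cS; have := card_connected cS.
rewrite /genus /betti1 (eqP cS); lia.
Qed.

Lemma genus_mono g S A : subcurve_connected S -> subcurve_connected A ->
  S \subset A -> (genus g S <= genus g A)%N.
Proof.
move=> cS cA SA; have [x xS] := connected_neq0 cS.
have S0 : S != set0 by apply/set0Pn; exists x.
have := card_edges_grow cA SA S0.
have := genus_connected g cS; have := genus_connected g cA.
rewrite (big_setID S) /= (setIidPr SA); lia.
Qed.

Lemma closure_connected S : subcurve_connected S ->
  subcurve_connected (closure_of S).
Proof.
move=> cS; have [x xS] := connected_neq0 cS.
apply: (@connectedI _ x) => [|A xA clA]; first by rewrite inE xS.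
have SA : S \subset A.
  by apply: (connected_sub cS xS xA) => h hA hS; apply: clA; rewrite // inE hS.
rewrite subUset SA; apply/subsetP => _ /imsetP[h + ->].
rewrite inE => hS; apply: clA; first exact: (subsetP SA).
by rewrite inE; apply/orP; right; apply/imsetP; exists h; rewrite ?inE.
Qed.

Lemma hend_closure_of S h : hstart h \in S -> hend h \in closure_of S.
Proof. by move=> hS; rewrite inE; apply/orP; right; apply: imset_f; rewrite inE. Qed.

Lemma closure_ofP S y : y \in closure_of S -> y \notin S ->
  exists h, hstart h = y /\ hend h \in S.
Proof.
rewrite inE => /orP[->//|/imsetP[h]]; rewrite inE => hS -> _.
by exists (hrev h); rewrite hstart_rev hend_rev.
Qed.

Lemma card_half_in S :
  #|[set h | (hstart h \in S) && (hend h \in S)]| = (2 * #|edges_in S|)%N.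
Proof.
have -> : [set h | (hstart h \in S) && (hend h \in S)] = setX (edges_in S) setT.
  by apply/setP => h; rewrite [h in RHS]surjective_pairing in_setX
    edges_in_half !inE andbT.
by rewrite cardsX cardsT card_bool mulnC.
Qed.

Lemma slope_rev (f : vert G -> R) h : slope f (hrev h) = - slope f h.
Proof. by rewrite /slope hstart_rev hend_rev -mulNr opprB. Qed.

Lemma sum_half_in (f : vert G -> R) S :
  \sum_(h | (hstart h \in S) && (hend h \in S)) slope f h = 0.
Proof.
set s := LHS; suff : s = - s by lra.
rewrite {1}/s (reindex_inj (inv_inj hrevK)) /s -sumrN.
apply: eq_big => [h|h _]; first by rewrite hstart_rev hend_rev andbC.
exact: slope_rev.
Qed.

Lemma sum_div_out (f : vert G -> R) S :
  \sum_(x in S) div_in setT f x =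
  \sum_(h | (hstart h \in S) && (hend h \notin S)) slope f h.
Proof.
transitivity (\sum_(h | hstart h \in S) slope f h).
  rewrite [RHS](partition_big (@hstart R G) (mem S)) //=.
  apply: eq_bigr => x xS; apply: eq_bigl => h; rewrite inE andbT.
  by have [->|] := eqVneq (hstart h) x; rewrite ?xS ?andbT ?andbF.
rewrite (bigID (fun h => hend h \in S)) /= sum_half_in add0r //.
Qed.

Lemma sum_val_in S A : (\sum_(x in S) val_in A x =
  #|[set h | (hstart h \in S) && (hend h \in A)]|)%N.
Proof.
rewrite -sum1dep_card.
rewrite (partition_big (@hstart R G) (mem S)) /=; last by move=> h /andP[].
apply: eq_bigr => x xS; rewrite /val_in -sum1dep_card; apply: eq_bigl => h.
by have [->|] := eqVneq (hstart h) x; rewrite ?xS ?andbT ?andbF.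
Qed.

End Connected.

(** * Trees *)

Section Tree.
Variables (R : realType) (G : mgraph R).
Hypothesis G_connected : subcurve_connected [set: vert G].
Hypothesis G_tree : betti1 [set: vert G] = 0%N.
Implicit Types (S C U : {set vert G}) (h k : edge G * bool).

Lemma card_edges_tree : #|edges_in [set: vert G]|.+1 = #|[set: vert G]|.
Proof.
have := card_connected G_connected; have := G_tree.
by rewrite /betti1 (eqP G_connected); lia.
Qed.

Lemma card_edges_forest S : S != set0 -> (#|edges_in S| < #|S|)%N.
Proof.
by move=> S0; have := card_edges_grow G_connected (subsetT S) S0;
  have := card_edges_tree; lia.
Qed.

Lemma card_edges_subtree S : subcurve_connected S -> #|edges_in S|.+1 = #|S|.
Proof.
move=> cS; have [x xS] := connected_neq0 cS.
have S0 : S != set0 by apply/set0Pn; exists x.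
by have := card_connected cS; have := card_edges_forest S0; lia.
Qed.

Lemma tree_no_loop h : hstart h != hend h.
Proof.
apply/eqP => hh; have := card_edges_forest (S := [set hstart h]).
rewrite cards1 => /(_ _); suff: (0 < #|edges_in [set hstart h]|)%N.
  have : [set hstart h] != set0 by apply/set0Pn; exists (hstart h); rewrite inE.
  by move=> S0 H /(_ S0); lia.
by apply/card_gt0P; exists h.1; rewrite edges_in_half -hh !inE eqxx.
Qed.

(* [C] is the component of the complement of [w] containing [U]. *)
Lemma tree_branch U w : subcurve_connected U -> w \notin U ->
  exists C, exists h,
    [/\ U \subset C, subcurve_connected C, hstart h = w & w \notin C] /\
    forall k, ((hstart k \notin C) && (hend k \in C)) = (k == h).
Proof.
move=> cU wU; have [u uU] := connected_neq0 cU.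
pose C := [set y | connect (adj_in (~: [set w])) u y].
have uC : u \in C by rewrite inE.
have Cw : C \subset ~: [set w].
  apply/subsetP => y; rewrite (in_set (connect _ u)).
  by move=> uy; apply: (connect_invariant _ _ uy) => //;
    rewrite !inE; apply: contraNneq wU => <-.
have wC : w \notin C.
  by apply/negP => /(subsetP Cw); rewrite !inE eqxx.
have clC : closed_in (~: [set w]) C.
  move=> h hC hw; rewrite inE; move: (hC); rewrite inE => /connect_trans; apply.
  apply/connect1/and3P; split=> //; first exact: (subsetP Cw).
  by apply/existsP; exists h; rewrite !eqxx.
have UC : U \subset C.
  apply: (connected_sub cU uU uC) => h hC hU; apply: clC => //.
  by rewrite !inE; apply: contraNneq wU => <-.
have cC : subcurve_connected C.
  apply: (connectedI uC) => A uA clA.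
  suff /subsetP sub : C \subset A :&: C.
    by apply/subsetP => y /sub; rewrite inE => /andP[].
  apply/subsetP => y; rewrite (in_set (connect _ u)).
  move=> uy; apply: (connect_invariant _ _ uy); last by rewrite inE uA.
  move=> h; rewrite inE => /andP[hA hC] hw; have hC' := clC _ hC hw.
  by rewrite inE hC' clA.
have startw k : hstart k \notin C -> hend k \in C -> hstart k = w.
  move=> sC eC; apply/eqP; apply: contraNT sC => sw.
  by rewrite -hend_rev; apply: clC; rewrite ?hstart_rev ?hend_rev // !inE.
have nC : C != setT by apply/eqP => CT; rewrite CT inE in wC.
have [h0 [h0C _ h0nC]] := connected_exit G_connected (subsetT C) uC nC.
pose h := hrev h0.
have hC : hend h \in C by rewrite hend_rev.
have hnC : hstart h \notin C by rewrite hstart_rev.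
exists C, h; split; first by split=> //; apply: startw.
move=> k; apply/andP/eqP => [[kn kC]|-> //].
apply/eqP/negPn/negP => kh.
have ke : k.1 != h.1.
  apply: contraNneq kn => ke.
  have [khE|->] := half_edge_eq ke; first by rewrite khE eqxx in kh.
  by rewrite hstart_rev.
have := card_edges_forest (S := w |: C); have := card_edges_subtree cC.
rewrite cardsU1 wC => cE /(_ _); rewrite -cards_eq0 cardsU1 wC => /(_ isT).
have kE : k.1 \notin edges_in C by rewrite edges_in_half (negbTE kn).
have hE : h.1 \notin k.1 |: edges_in C.
  by rewrite in_setU1 eq_sym (negbTE ke) edges_in_half (negbTE hnC).
suff : (#|h.1 |: (k.1 |: edges_in C)| <= #|edges_in (w |: C)|)%N.
  rewrite !cardsU1 hE kE !add1n -cE ltnS => le1 /leq_ltn_trans - /(_ _ le1).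
  by rewrite ltnn.
apply/subset_leq_card; rewrite !subUset !sub1set !edges_in_half edges_inS ?subsetUr //.
by rewrite !in_setU1 hC kC (startw k) // (startw h) // eqxx !orbT.
Qed.

Lemma card_edges_branch C h :
  subcurve_connected C ->
  (forall k, ((hstart k \notin C) && (hend k \in C)) = (k == h)) ->
  #|edges_in (~: C)|.+1 = #|~: C|.
Proof.
move=> cC uniq_h; have := card_edges_subtree cC; have := card_edges_tree.
have := cardsC C; have := card_half_in C; have := card_half_in (~: C).
have := card_half_in [set: vert G]; rewrite cardsT.
set HT := [set k | _]; set HC' := [set k | _]; set HC := [set k | _].
have -> : HT = h |: (hrev h |: (HC :|: HC')).
  apply/setP => k; rewrite !inE -!uniq_h -(inv_eq (@hrevK R G)) -uniq_h.
  by rewrite hstart_rev hend_rev; case: (_ \in C); case: (_ \in C).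
have HhC k : k == h -> (hstart k \in C) = false /\ hend k \in C.
  by rewrite -uniq_h => /andP[/negbTE].
have [hs he] := HhC h (eqxx h).
rewrite !cardsU1 !inE !hstart_rev !hend_rev hs he /= orbF.
have -> : (h == hrev h) = false.
  by apply/eqP => /(congr1 (@hstart R G)); rewrite hstart_rev => e; rewrite e he in hs.
have -> : #|HC :|: HC'| = (#|HC| + #|HC'|)%N.
  rewrite cardsU; suff -> : HC :&: HC' = set0 by rewrite cards0 subn0.
  by apply/setP => k; rewrite !inE; case: (hstart k \in C); rewrite /= ?andbF.
by rewrite /=; lia.
Qed.

End Tree.

Lemma min_principle (R : realType) (G : mgraph R) (f : vert G -> R) (v : vert G) :
  subcurve_connected [set: vert G] -> (forall e : edge G, 0 < len e) ->
  (forall p, p != v -> div_in setT f p <= 0) -> forall p, f v <= f p.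
Proof.
move=> cG len0 div_le p; pose m := [arg min_(i < v) f i]%O.
have fm q : f m <= f q by rewrite /m; case: arg_minP => //= i _; apply.
pose M := [set q | f q == f m].
suff vM : v \in M by move: vM; rewrite inE => /eqP ->.
apply/negPn/negP => vM; have /subsetP sub : setT \subset M.
  apply: (connected_sub cG (in_setT m)); first by rewrite inE.
  move=> h; rewrite inE => /eqP hM _; have ps k : hstart k = hstart h -> 0 <= slope f k.
    by move=> kh; rewrite /slope divr_ge0 ?(ltW (len0 _)) // subr_ge0 kh hM fm.
  have : div_in setT f (hstart h) <= 0.
    by apply: div_le; apply: contraNneq vM => <-; rewrite inE hM.
  rewrite /div_in (bigD1 h) /=; last by rewrite eqxx inE.
  set s := \sum_(_ | _) _; have s0 : 0 <= s.
    by apply: sumr_ge0 => k /andP[/andP[/eqP kh _] _]; apply: ps.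
  have := ps h erefl; move=> h0 le0; have : slope f h = 0 by lra.
  move/eqP; rewrite /slope mulf_eq0 invr_eq0 (gt_eqF (len0 _)) orbF subr_eq0 => /eqP fh.
  by rewrite inE fh hM.
by have := sub v (in_setT v); rewrite (negbTE vM).
Qed.

(** * Double covers *)

Section Cover.
Variables (R : realType) (Z : double_cover R).
Hypothesis hZ : is_double_cover Z.
Implicit Types (S U C : {set vert (GamT Z)}) (f : vert (GamT Z) -> R).

Let GT_conn := GamT_connected hZ.
Let GT_tree := GamT_tree hZ.

Lemma psi_lift (x : vert (Gam Z)) (k : edge (GamT Z) * bool) :
  hstart k = psiV x -> exists h, hstart h = x /\ psiH h = k.
Proof.
move=> kx; case: (pickP (fun h => (hstart h == x) && (psiH h == k))).
  by move=> h /andP[/eqP ? /eqP ?]; exists h.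
by move=> no; have := degV_gt0 hZ x; rewrite -(harmonic hZ kx) big_pred0.
Qed.

Lemma psi_surj (v : vert (GamT Z)) : exists x, psiV x = v.
Proof.
case: (pickP (fun x => psiV x == v)) => [x /eqP|no]; first by exists x.
by have := degree2 hZ v; rewrite big_pred0.
Qed.

Lemma preim_connected U S : subcurve_connected (@psiV R Z @^-1: U) ->
  U \subset S -> subcurve_connected S -> subcurve_connected (@psiV R Z @^-1: S).
Proof.
move=> cU US cS; have [x] := connected_neq0 cU; rewrite inE => xU.
have xS := subsetP US _ xU.
apply: (@connectedI _ _ _ x) => [|A xA clA]; first by rewrite inE.
have /subsetP UA : @psiV R Z @^-1: U \subset A.
  apply: (connected_sub cU _ xA) => [|h hA]; rewrite inE // => hU.
  by apply: clA; rewrite // inE; apply: (subsetP US).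
pose B := [set v in S | [forall y, (psiV y == v) ==> (y \in A)]].
suff /subsetP SB : S \subset B.
  apply/subsetP => y; rewrite inE => /SB; rewrite inE => /andP[_ /forallP/(_ y)].
  by rewrite eqxx.
apply: (connected_sub cS xS).
  rewrite inE xS; apply/forallP => y; apply/implyP => /eqP yx.
  by apply: UA; rewrite inE yx.
move=> h; rewrite inE => /andP[hS /forallP hB] hS'; rewrite inE hS'.
apply/forallP => y; apply/implyP => /eqP yh.
have [|k [ky kh]] := @psi_lift y (hrev h); first by rewrite hstart_rev.
rewrite -ky -hend_rev; apply: clA; last by rewrite hend_rev ky inE yh.
rewrite hstart_rev; have := hB (hend k); rewrite (psi_hend hZ) kh hend_rev eqxx.
by [].
Qed.

Lemma psi_connected (P : {set vert (Gam Z)}) :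
  subcurve_connected P -> subcurve_connected (@psiV R Z @: P).
Proof.
move=> cP; have [x xP] := connected_neq0 cP.
apply: (@connectedI _ _ _ (psiV x)) => [|A xA clA]; first exact: imset_f.
have /subsetP sub : P \subset @psiV R Z @^-1: A.
  apply: (connected_sub cP xP); first by rewrite inE.
  move=> h; rewrite !inE (psi_hstart hZ) => hA hP.
  rewrite (psi_hend hZ); apply: clA => //.
  by rewrite -(psi_hend hZ) imset_f.
by apply/subsetP => _ /imsetP[y yP ->]; have := sub y yP; rewrite inE.
Qed.

Lemma psi_preimK S : @psiV R Z @: (@psiV R Z @^-1: S) = S.
Proof.
apply/setP => v; apply/imsetP/idP => [[x + ->]|vS]; first by rewrite inE.
by have [x xv] := psi_surj v; exists x; rewrite // inE xv.
Qed.

Lemma psi_closure (P : {set vert (Gam Z)}) S : P = @psiV R Z @^-1: S ->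
  @psiV R Z @: closure_of P = closure_of S.
Proof.
move=> PE; apply/setP => v; apply/imsetP/idP => [[x + ->]|].
  rewrite inE => /orP[|/imsetP[h]]; first by rewrite PE !inE => ->.
  rewrite inE PE inE (psi_hstart hZ) => hS ->; rewrite (psi_hend hZ).
  exact: (hend_closure_of hS).
rewrite inE => /orP[vS|/imsetP[k]].
  by have [x xv] := psi_surj v; exists x; rewrite // inE PE inE xv vS.
rewrite inE => kS ->; have [y yk] := psi_surj (hstart k).
have [h [hy hk]] := psi_lift (esym yk).
exists (hend h); last by rewrite (psi_hend hZ) hk.
by apply: hend_closure_of; rewrite PE inE (psi_hstart hZ) hk.
Qed.

Lemma cover_count S :
  let P := @psiV R Z @^-1: S in
  (2 * (\sum_(x in P) vgen x) + 2 * #|edges_in P| + 4 * #|S| =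
   2 * #|P| + 4 * #|edges_in S| + \sum_(v in S) branchdeg_in S v)%N.
Proof.
move=> P; pose zero := fun _ : vert (GamT Z) => 0 : R.
have D0 v : D zero S v = D' S v.
  by rewrite /D /div_in big1 ?addr0 // => h _; rewrite /slope subrr mul0r.
have KP : \sum_(x in P) (degV x)%:R * D zero S (psiV x) =
    2 * (\sum_(x in P) vgen x)%:R - 2 * #|P|%:R + 2 * #|edges_in P|%:R :> R.
  rewrite (eq_bigr _ (fun x _ => pullback_D hZ S zero x)).
  rewrite big_split /= [X in _ + X]big1 ?addr0; last first.
    by move=> x _; rewrite /div_in big1 // => h _; rewrite /slope subrr mul0r.
  rewrite !big_split /= sumrN sumr_const -[2 *+ _]mulr_natr -mulr_sumr -!natr_sum.
  by rewrite sum_val_in card_half_in natrM.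
have KS : \sum_(x in P) (degV x)%:R * D zero S (psiV x) =
    4 * #|edges_in S|%:R - 4 * #|S|%:R + (\sum_(v in S) branchdeg_in S v)%:R :> R.
  rewrite (partition_big (@psiV R Z) (mem S)) /=; last by move=> x; rewrite inE.
  transitivity (\sum_(v in S) 2 * D' S v).
    apply: eq_bigr => v vS; rewrite -(degree2 hZ v) natr_sum mulr_suml.
    apply: eq_big => x; last by move=> /andP[_ /eqP ->]; rewrite D0.
    by rewrite inE; have [->|] := eqVneq; rewrite ?vS ?andbF.
  rewrite -mulr_sumr 2!big_split /= sumrN sumr_const -[2 *+ _]mulr_natr -mulr_suml.
  by rewrite -!natr_sum sum_val_in card_half_in natrM; field.
apply/eqP; rewrite -(eqr_nat R) !(natrD, natrM); apply/eqP; lra.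
Qed.

(* Riemann-Hurwitz for the restriction of the cover to [S]. *)
Lemma branchdeg_genus S : subcurve_connected S ->
  subcurve_connected (@psiV R Z @^-1: S) ->
  (\sum_(v in S) branchdeg_in S v =
   2 * genus (@vgen R Z) (@psiV R Z @^-1: S) + 2)%N.
Proof.
move=> cS cP; have := card_edges_subtree GT_conn GT_tree cS.
have := genus_connected (@vgen R Z) cP; have := cover_count S; lia.
Qed.

Section GenusTwo.
Variable U : {set vert (GamT Z)}.
Hypothesis U_connected : subcurve_connected (@psiV R Z @^-1: U).
Hypothesis U_genus : genus (@vgen R Z) (@psiV R Z @^-1: U) = 2%N.

Let cU : subcurve_connected U.
Proof. by have := psi_connected U_connected; rewrite psi_preimK. Qed.

Lemma genus_super S : subcurve_connected S -> U \subset S ->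
  genus (@vgen R Z) (@psiV R Z @^-1: S) = 2%N.
Proof.
move=> cS US; have cP := preim_connected U_connected US cS.
have := genus_mono (@vgen R Z) U_connected cP (preimsetS _ US).
have := genus_mono (@vgen R Z) cP (Gam_connected hZ) (subsetT _).
by rewrite U_genus (Gam_genus hZ) => le2 ge2; apply/eqP; rewrite eqn_leq le2.
Qed.

Lemma branchdeg_super S : subcurve_connected S -> U \subset S ->
  (\sum_(v in S) branchdeg_in S v = 6)%N.
Proof.
move=> cS US; rewrite branchdeg_genus // ?genus_super //.
exact: (preim_connected U_connected US cS).
Qed.

End GenusTwo.
End Cover.

(** * Admissible functions away from the positive locus *)

Section Core.
Variables (R : realType) (Z : double_cover R).
Hypothesis hZ : is_double_cover Z.

Definition admissible_at (v0 : vert (GamT Z)) (f : vert (GamT Z) -> R) :=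
  forall p, D' setT p + div_in setT f p = (p == v0)%:R.

Lemma branchdeg_in_setT (v : vert (GamT Z)) : branchdeg_in setT v = branchdeg v.
Proof.
rewrite /branchdeg_in eq_card0 ?addn0 // => h.
by rewrite !inE andbF.
Qed.

Lemma sum_branchdeg_in (S : {set vert (GamT Z)}) :
  (\sum_(v in S) branchdeg_in S v = \sum_(v in S) branchdeg v +
   #|[set h | [&& hstart h \in S, hend h \notin S & ramified h.1]]|)%N.
Proof.
rewrite big_split /=; congr (_ + _)%N; rewrite -sum1dep_card.
rewrite [RHS](partition_big (@hstart R _) (mem S)) /=; last by move=> h /andP[].
apply: eq_bigr => v vS; rewrite -sum1dep_card; apply: eq_bigl => h.
by have [->|] := eqVneq (hstart h) v; rewrite ?vS ?andbT ?andbF.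
Qed.

Variable U : {set vert (GamT Z)}.
Hypothesis U_connected : subcurve_connected (@psiV R Z @^-1: U).
Hypothesis U_genus : genus (@vgen R Z) (@psiV R Z @^-1: U) = 2%N.

Let GT_conn := GamT_connected hZ.
Let GT_tree := GamT_tree hZ.
Let U_connectedT : subcurve_connected U.
Proof. by have := psi_connected hZ U_connected; rewrite (psi_preimK hZ). Qed.

(* [b] is the number of branch points on the complement of [C], the branch of
   the tree at [w] pointing away from [U]. Since [C] already has genus two, its
   own branch points and the ramification of [h] make up all six. *)
Lemma outer_branch (w : vert (GamT Z)) : w \notin U ->
  exists C : {set vert (GamT Z)}, exists h, exists b : nat,
  [/\ [/\ U \subset C, hstart h = w, w \notin C &
        forall k, ((hstart k \notin C) && (hend k \in C)) = (k == h)],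
      (b <= 1)%N,
      branchdeg_in (w |: C) w = b
    & forall f v0, admissible_at v0 f ->
        slope f h = (v0 \notin C)%:R + 1 - b%:R / 2].
Proof.
move=> wU; have [C [h [[UC cC hw wC] hC]]] :=
  tree_branch GT_conn GT_tree U_connectedT wU.
have /andP[hsC heC] : (hstart h \notin C) && (hend h \in C) by rewrite hC.
pose br (S : {set vert (GamT Z)}) := (\sum_(v in S) branchdeg v)%N.
have br6 : (br C + br (~: C) = 6)%N.
  rewrite -(branchdeg_super hZ U_connected U_genus GT_conn (subsetT _)).
  rewrite [RHS](eq_bigr _ (fun v _ => branchdeg_in_setT v)).
  by rewrite [RHS](big_setID C) /= setTI setTD.
have brC : (br C + ramified h.1 = 6)%N.
  rewrite -(branchdeg_super hZ U_connected U_genus cC UC) sum_branchdeg_in.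
  congr (_ + _)%N; transitivity #|[set k | (k == hrev h) && ramified h.1]|.
    case: (ramified h.1).
      rewrite (_ : [set _ | _] = [set hrev h]) ?cards1 //.
      by apply/setP => k; rewrite !inE andbT.
    by rewrite eq_card0 // => k; rewrite !inE andbF.
  apply: eq_card => k; have := hC (hrev k); rewrite hstart_rev hend_rev => hk.
  rewrite !in_set andbA [X in _ = X && _]andbC hk (inv_eq (@hrevK R _)).
  by have [->|] := eqVneq k (hrev h).
have br_wC : (br C + branchdeg_in (w |: C) w = 6)%N.
  have cwC : subcurve_connected (w |: C).
    by rewrite -hw -hend_rev; apply: connected_setU1; rewrite ?hstart_rev.
  rewrite -(branchdeg_super hZ U_connected U_genus cwC); last first.
    exact: (subset_trans UC (subsetUr _ _)).
  rewrite big_setU1 //= addnC; congr (_ + _)%N; apply: eq_bigr => v vC.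
  rewrite /branchdeg_in eq_card0 ?addn0 // => k; rewrite !inE negb_or.
  apply/negP => /and3P[/eqP kv /andP[kw kC] _].
  have : hrev k == h by rewrite -hC hstart_rev hend_rev kC kv.
  by move=> /eqP kh; rewrite -hstart_rev kh hw eqxx in kw.
exists C, h, (br (~: C)); split=> //; [|by lia|].
  by case: (ramified h.1) brC; lia.
move=> f v0 adm; have :
    \sum_(v in ~: C) (D' setT v + div_in setT f v) = (v0 \notin C)%:R.
  rewrite (eq_bigr _ (fun v _ => adm v)); have [vC|vC] := boolP (v0 \in C).
    rewrite big1 // => v; rewrite inE; case: eqVneq => // ->; by rewrite vC.
  rewrite (bigD1 v0) ?inE //= eqxx big1 ?addr0 // => v /andP[_ /negbTE ->].
  by [].
rewrite big_split /= sum_div_out (big_pred1 h); last first.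
  by move=> k; rewrite !inE negbK hC.
have cE := card_edges_branch GT_conn GT_tree cC hC.
have val : (\sum_(v in ~: C) val_in setT v = 2 * #|edges_in (~: C)| + 1)%N.
  rewrite sum_val_in -card_half_in -[X in (_ + X)%N](cards1 h).
  rewrite -[LHS](cardsID [set k | hend k \in ~: C]); congr (_ + _)%N.
    by apply: eq_card => k; rewrite !inE andbT.
  by apply: eq_card => k; rewrite !inE negbK andbT andbC hC.
rewrite 2!big_split /= sumrN sumr_const -[2 *+ _]mulr_natr -mulr_suml -!natr_sum val.
rewrite (eq_bigr _ (fun v _ => branchdeg_in_setT v)) -cE -/(br _).
by rewrite natrD natrM -[#|_|.+1]addn1 natrD => <-; lra.
Qed.

Lemma admissible_lt0 (f : vert (GamT Z) -> R) v0 w : admissible_at v0 f ->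
  (forall p, p \notin U -> f p <= 0) -> w \notin closure_of U -> f w < 0.
Proof.
move=> adm f_le0 wK; have wU : w \notin U by apply: contra wK; rewrite inE => ->.
have [C [h [b [[_ hw _ _] b1 _ /(_ f v0 adm) sl]]]] := outer_branch wU.
have : 0 < slope f h.
  rewrite sl; have : b%:R <= 1 :> R by rewrite (ler_nat R b 1).
  by case: (_ \notin _) => /= ?; lra.
rewrite /slope pmulr_lgt0 ?invr_gt0 ?(lenT_gt0 hZ) // subr_gt0 hw => /lt_le_trans.
apply; apply: f_le0; apply: contra wK => eU.
by rewrite -hw -hend_rev; apply: hend_closure_of; rewrite hstart_rev.
Qed.

Lemma is_Delta_closure (g : vert (GamT Z) -> R) (Delta : {set vert (Gam Z)}) :
  pos_locusT g = U -> is_Delta g Delta -> @psiV R Z @: Delta = closure_of U.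
Proof.
move=> gU; have PE : pos_locus g = @psiV R Z @^-1: U.
  by rewrite -gU; apply/setP => x; rewrite !inE.
move=> /minsetP[/and3P[sub _ _] min].
rewrite -(psi_closure hZ PE) (min (closure_of (pos_locus g)) _ sub) //.
have cK : subcurve_connected (closure_of (pos_locus g)).
  by rewrite PE; apply: closure_connected.
rewrite subxx cK /= eqn_leq -{1}(Gam_genus hZ) -{1}U_genus -PE.
rewrite !genus_mono ?subsetT ?subsetUl // ?PE //; exact: (Gam_connected hZ).
Qed.

Lemma special_boundary (g f : vert (GamT Z) -> R) (v : vert (GamT Z)) :
  v \in closure_of U :\: U -> admissible_at v f ->
  {in closure_of U, g =1 f} -> special g (closure_of U) = [set v].
Proof.
set K := closure_of U => vKU adm gf.
have /andP[vU vK] : (v \notin U) && (v \in K) by rewrite -in_setD.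
have entry p : p \in K -> p \notin U -> exists k, hstart k = p /\ hend k \in U.
  exact: closure_ofP.
have leave k : hstart k \in U -> hend k \in K by exact: hend_closure_of.
have UK : U \subset K := subsetUl _ _.
clearbody K.
suff DE p : p \in K -> D g K p = (p == v)%:R.
  apply/setP => p; rewrite in_set in_set1; apply/andP/eqP => [[pK]|->].
    by rewrite DE // pnatr_eq0 eqb0 negbK => /eqP.
  by rewrite DE // eqxx oner_neq0.
move=> pK; have [pU|pU] := boolP (p \in U).
  have endK h : hstart h == p -> hend h \in K.
    by move=> /eqP hp; apply: leave; rewrite hp.
  rewrite -(adm p) /D /D'; congr (_ + _).
    congr (_%:R - 2 + _%:R / 2).
      apply: eq_card => h; rewrite !inE andbT.
      by case: eqP => // /eqP /endK ->.
    congr (_ + _)%N; apply: eq_card => h; rewrite !inE andbF.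
    by case: eqP => // /eqP /endK ->.
  apply: eq_big => h; first by rewrite inE andbT; case: eqP => // /eqP /endK ->.
  by move=> /andP[/eqP hp hK]; rewrite /slope !gf // hp.
have [C [h [b [[UC hp pC hC] b1 bE /(_ f v adm) sl]]]] := outer_branch pU.
have toC k : hstart k \notin C -> hend k \in C -> k = h.
  by move=> *; apply/eqP; rewrite -hC; apply/andP.
have noloop k : hstart k = p -> hend k != p.
  by move=> <-; rewrite eq_sym (tree_no_loop GT_conn GT_tree).
have hU : hend h \in U.
  have [j [jp jU]] := entry _ pK pU.
  by rewrite -(toC j) ?jp ?(subsetP UC _ jU).
have hK : hend h \in K := subsetP UK _ hU.
have inK k : hstart k = p -> (hend k \in K) = (k == h).
  move=> kp; apply/idP/eqP => [kK|->//].
  apply: (toC); rewrite ?kp //; apply/negPn/negP => kC.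
  have [|j [jk jU]] := entry _ kK; first by apply: contra kC; apply: (subsetP UC).
  have jh : j = h by apply: toC; rewrite ?jk ?(subsetP UC _ jU).
  by have := noloop k kp; rewrite -jk jh hp eqxx.
have inwC k : hstart k = p -> (hend k \in p |: C) = (k == h).
  by move=> kp; rewrite in_setU1 (negbTE (noloop k kp)) -hC kp pC.
have -> : D g K p = 1 - 2 + b%:R / 2 + slope f h.
  rewrite /D /D'; congr (_ + _).
    congr (_ - 2 + _%:R / 2).
      rewrite /val_in (_ : [set _ | _] = [set h]) ?cards1 //; apply/setP => k.
      rewrite in_set in_set1; case: eqP => [kp|kp]; first by rewrite inK.
      by apply/esym/eqP => kh; rewrite kh in kp.
    rewrite -bE; congr (_ + _)%N; apply: eq_card => k; rewrite in_set [RHS]in_set.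
    by case: eqP => // kp; rewrite inK ?inwC.
  rewrite /div_in (big_pred1 h) => [|k].
    by rewrite /slope !gf // hp.
  case: eqP => [kp|kp]; first by rewrite inK.
  by apply/esym/eqP => kh; rewrite kh in kp.
have -> : (p == v) = (v \notin C).
  apply/eqP/idP => [<-//|vC]; have [j [jv jU]] := entry _ vK vU.
  by rewrite -hp -jv; congr hstart; apply/esym/toC; rewrite ?jv ?(subsetP UC _ jU).
rewrite sl; lra.
Qed.

End Core.

(** * Subdivisions *)

#[local] Arguments sub_point : simpl never.

Section Subdivision.
Variables (R : realType) (G : mgraph R) (s : subdiv G).
Notation SG := (sub_graph s).

Definition sub_half (h : edge G * bool) : edge SG * bool :=
  if h.2 then (existT (fun e => 'I_(npts s e).+1) h.1 ord_max, true)
  else (existT (fun e => 'I_(npts s e).+1) h.1 ord0, false).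

Lemma sub_half_tag h : (tag (sub_half h).1, (sub_half h).2) = h.
Proof. by case: h => e []. Qed.

Lemma sub_point_last e : sub_point s e (npts s e).+1 = inl (tgt e).
Proof. by rewrite /sub_point insubN // -leqNgt. Qed.

Lemma sub_point_inner (q : {e : edge G & 'I_(npts s e)}) :
  sub_point s (tag q) (tagged q).+1 = inr q.
Proof.
case: q => e j; rewrite /sub_point /= insubT //= => ltj.
by congr (inr (existT _ _ _)); apply: val_inj.
Qed.

Lemma sub_point_inl e (i : nat) u : (i <= (npts s e).+1)%N ->
  sub_point s e i = inl u ->
  (i = 0 /\ src e = u) \/ (i = (npts s e).+1 /\ tgt e = u).
Proof.
rewrite /sub_point; case: i => [|j]; first by move=> _ [->]; left.
case: insubP => // ltj le [<-]; right; split=> //; apply/eqP.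
by rewrite eqSS eqn_leq -ltnS le leqNgt.
Qed.

Lemma sub_point_inr e i q : sub_point s e i = inr q -> tag q = e /\ i = (tagged q).+1.
Proof. by rewrite /sub_point; case: i => // j; case: insubP => // u _ <- [<-]. Qed.

Lemma hstart_sub_half h : hstart (sub_half h) = inl (hstart h).
Proof. by case: h => e []; rewrite // /hstart /= sub_point_last. Qed.

Lemma hstart_sub_inl (k : edge SG * bool) u :
  hstart k = inl u -> k = sub_half (tag k.1, k.2).
Proof.
case: k => -[e i] [] /=; rewrite /hstart /= /sub_half /=.
  case/sub_point_inl => [|[]//|[[ii] _]]; first by rewrite ltnS -ltnS.
  by congr (existT _ _ _, _); apply: val_inj.
case/sub_point_inl => [|[ii _]|[ii _]]; first exact/ltnW/ltn_ord.
  by congr (existT _ _ _, _); apply: val_inj.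
by have := ltn_ord i; rewrite ii ltnn.
Qed.

Lemma big_half_orig (T : Type) (idx : T) (op : Monoid.com_law idx)
    (F : edge SG * bool -> T) u :
  \big[op/idx]_(k : edge SG * bool | hstart k == inl u) F k =
  \big[op/idx]_(h | hstart h == u) F (sub_half h).
Proof.
rewrite (reindex_onto sub_half (fun k => (tag k.1, k.2))) /=; last first.
  by move=> k /eqP/hstart_sub_inl.
apply: eq_bigl => h; rewrite sub_half_tag eqxx andbT hstart_sub_half.
by apply/eqP/eqP => [[]|->].
Qed.

Definition half_after (q : {e : edge G & 'I_(npts s e)}) : edge SG * bool :=
  (existT (fun e => 'I_(npts s e).+1) (tag q) (lift ord0 (tagged q)), false).

Definition half_before (q : {e : edge G & 'I_(npts s e)}) : edge SG * bool :=
  (existT (fun e => 'I_(npts s e).+1) (tag q) (widen_ord (leqnSn _) (tagged q)),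
   true).

Lemma hstart_sub_inr (k : edge SG * bool) q :
  (hstart k == inr q) = (k == half_after q) || (k == half_before q).
Proof.
apply/eqP/orP => [|[]/eqP->]; last 2 first.
- by rewrite /hstart /= sub_point_inner.
- by rewrite /hstart /= sub_point_inner.
case: k q => -[e i] b [e' j]; rewrite /hstart /=; case: b => /=.
  case/sub_point_inr => /= ee; case: e / ee i => i [ij]; right.
  by apply/eqP; congr (existT _ _ _, _); apply: val_inj.
case/sub_point_inr => /= ee; case: e / ee i => i ij; left.
by apply/eqP; congr (existT _ _ _, _); apply: val_inj.
Qed.

Lemma big_half_new (T : Type) (idx : T) (op : Monoid.com_law idx)
    (F : edge SG * bool -> T) q :
  \big[op/idx]_(k : edge SG * bool | hstart k == inr q) F k =
  op (F (half_after q)) (F (half_before q)).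
Proof.
rewrite (eq_bigl _ _ (fun k => hstart_sub_inr k q)) (bigD1 (half_after q)) ?eqxx //=.
rewrite (bigD1 (half_before q)) /=; last by rewrite eqxx orbT xpair_eqE andbF.
rewrite big_pred0 ?Monoid.mulm1 // => k.
by case: (k == half_after q); case: (k == half_before q).
Qed.

Lemma val_in_setT (H : mgraph R) (v : vert H) :
  val_in setT v = \sum_(h | hstart h == v) 1%N.
Proof. by rewrite /val_in -sum1dep_card; apply: eq_bigl => h; rewrite inE andbT. Qed.

Lemma val_in_orig u : val_in [set: vert SG] (inl u) = val_in [set: vert G] u.
Proof. by rewrite !val_in_setT big_half_orig. Qed.

Lemma val_in_new q : val_in [set: vert SG] (inr q) = 2%N.
Proof. by rewrite val_in_setT big_half_new. Qed.

Lemma sub_point_closed (A : {set vert SG}) e i : closed_in setT A ->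
  (i <= (npts s e).+1)%N -> (sub_point s e i \in A) = (inl (src e) \in A).
Proof.
move=> clA; elim: i => // i IH le; rewrite -IH; last exact: ltnW.
pose a : edge SG := existT (fun e => 'I_(npts s e).+1) e (Ordinal le).
apply/idP/idP => pA; first exact: (clA (a, true)).
exact: (clA (a, false)).
Qed.

Lemma sub_graph_connected : subcurve_connected [set: vert G] ->
  subcurve_connected [set: vert SG].
Proof.
move=> cG; have [x _] := connected_neq0 cG.
apply: (@connectedI _ SG _ (inl x : vert SG)); first exact: in_setT.
move=> A xA clA.
have /subsetP sub : setT \subset [set u | inl u \in A].
  apply: (connected_sub cG (in_setT x)); first by rewrite inE.
  move=> [e b]; rewrite !inE => eA _.
  have st : (inl (tgt e) \in A) = (inl (src e) \in A).
    by rewrite -sub_point_last sub_point_closed.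
  by case: b eA; rewrite /hstart /hend /= st.
have inA u : inl u \in A by have := sub u (in_setT u); rewrite inE.
apply/subsetP => -[u|q] _ //.
by rewrite -sub_point_inner sub_point_closed //; apply/leqW/ltn_ord.
Qed.

Lemma card_sub_graph : (#|edge SG| + #|vert G| = #|vert SG| + #|edge G|)%N.
Proof.
rewrite card_sum !card_tagged !sumnE !big_map -!enumT !big_enum /=.
rewrite -addnA addnC; congr (_ + _)%N.
rewrite -sum1_card -big_split /=; apply: eq_bigr => e _.
by rewrite !card_ord addn1.
Qed.

Lemma genus_sub_graph (g : vert G -> nat) (g' : vert SG -> nat) :
  subcurve_connected [set: vert G] ->
  (\sum_(p in setT) g' p = \sum_(u in setT) g u)%N ->
  genus g' [set: vert SG] = genus g [set: vert G].
Proof.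
move=> cG gg; have := genus_connected g' (sub_graph_connected cG).
have := genus_connected g cG; have := card_sub_graph.
have edgesT (H : mgraph R) : edges_in [set: vert H] = setT.
  by apply/setP => e; rewrite !inE.
rewrite !edgesT !cardsT gg; lia.
Qed.

Definition sub_ext (f : vert G -> R) (p : vert SG) : R :=
  match p with
  | inl u => f u
  | inr q => on_edge f (tag q) (cut s (tag q) (tagged q).+1)
  end.

Hypothesis s_subdiv : is_subdiv s.
Hypothesis len_pos : forall e : edge G, 0 < len e.

Lemma sub_ext_point f e i : (i <= (npts s e).+1)%N ->
  sub_ext f (sub_point s e i) = on_edge f e (cut s e i).
Proof.
case: i => [_|i le].
  by rewrite /= /on_edge (cut_first s_subdiv) mul0r mulr0 addr0.
have [lti|gei] := ltnP i (npts s e).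
  by rewrite -[i]/(val (Ordinal lti)) (sub_point_inner (existT _ e (Ordinal lti))).
have -> : i = npts s e by apply/eqP; rewrite eqn_leq gei -ltnS le.
rewrite sub_point_last /= /on_edge (cut_last s_subdiv) divff ?gt_eqF //.
by rewrite mulr1 addrC subrK.
Qed.

Lemma slope_sub_ext f (k : edge SG * bool) :
  slope (sub_ext f) k = slope f (tag k.1, k.2).
Proof.
case: k => -[e i] b; have lti := ltn_ord i.
have l0 := len_pos e; have c0 := cut_lt s_subdiv (lti : i <= npts s e)%N.
rewrite /slope /hstart /hend /=.
by case: b; rewrite !sub_ext_point ?(ltnW lti) // /on_edge; field;
  rewrite subr_eq0 !gt_eqF.
Qed.

Lemma div_sub_ext_orig f u :
  div_in setT (sub_ext f) (inl u) = div_in setT f u.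
Proof.
rewrite /div_in.
have drop (H : mgraph R) (v : vert H) (F : edge H * bool -> R) :
    \sum_(h | (hstart h == v) && (hend h \in setT)) F h =
    \sum_(h | hstart h == v) F h.
  by apply: eq_bigl => h; rewrite inE andbT.
rewrite !drop big_half_orig; apply: eq_bigr => h _.
by rewrite slope_sub_ext sub_half_tag.
Qed.

Lemma div_sub_ext_new f q : div_in setT (sub_ext f) (inr q) = 0.
Proof.
rewrite /div_in (eq_bigl (fun k : edge SG * bool => hstart k == inr q)).
  2: by move=> k; rewrite inE andbT.
rewrite big_half_new !slope_sub_ext /=.
by rewrite -[(tag q, true)]/(hrev (tag q, false)) slope_rev subrr.
Qed.

End Subdivision.

(** * Subdivided covers *)

Section SubdividedCover.
Variables (R : realType) (X : double_cover R) (s : subdiv (GamT X)).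
Hypothesis hX : is_double_cover X.
Hypothesis s_subdiv : is_subdiv s.
Notation Y := (sub_cover s).

Lemma psiV_sub_point (e : edge (Gam X)) i :
  @psiV R Y (sub_point (sub_pull s) e i) = sub_point s (psiE e) i.
Proof.
case: i => [|j]; first by rewrite /sub_point /= (psi_src hX).
by rewrite /sub_point /=; case: insubP => //= _; rewrite (psi_tgt hX).
Qed.

Lemma degE_gt0 (e : edge (Gam X)) : (0 < degE e)%N.
Proof. by have /orP[/eqP->|/eqP->] := degE12 hX e. Qed.

Lemma degE_fiber (e : edge (GamT X)) : (\sum_(e' | psiE e' == e) degE e' = 2)%N.
Proof.
rewrite -(degree2 hX (src e)).
rewrite (partition_big (@src R (Gam X)) (fun x => psiV x == src e)) /=; last first.
  by move=> e' /eqP <-; rewrite (psi_src hX).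
apply: eq_bigr => x /eqP xe; rewrite -(harmonic hX (k := (e, false))) //.
rewrite (reindex_onto (fun e' => (e', false)) fst) /=; last first.
  by move=> [e' b] /andP[_ /eqP[_ ->]].
by apply: eq_bigl => e'; rewrite eqxx andbT andbC /psiH xpair_eqE andbT.
Qed.

Lemma psiH_sub_half (h : edge (Gam X) * bool) :
  @psiH R Y (sub_half (sub_pull s) h) = sub_half s (psiH h).
Proof. by case: h => e []. Qed.

Lemma sub_half_inj (G : mgraph R) (t : subdiv G) : injective (sub_half t).
Proof. by move=> h k hk; rewrite -(sub_half_tag t h) hk sub_half_tag. Qed.

Lemma sub_cover_degree2 (v : vert (GamT Y)) :
  (\sum_(x : vert (Gam Y) | psiV x == v) degV x = 2)%N.
Proof.
rewrite big_sumType /=; case: v => [v|[e j]].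
  rewrite [X in (_ + X)%N]big_pred0 // addn0 -(degree2 hX v).
  by apply: eq_bigl => x; apply/eqP/eqP => [[]|->].
rewrite big_pred0 // add0n -(degE_fiber e).
rewrite (partition_big (fun q => tag q) (fun e' => psiE e' == e)) /=; last first.
  by move=> [e' j'] /eqP[ee _]; apply/eqP.
apply: eq_bigr => e' /eqP ee; case: e / ee j => j.
rewrite (big_pred1 (existT _ e' j)) // => -[e2 j2] /=.
have [ee|ne] := eqVneq e2 e'; last first.
  by rewrite andbF; apply/esym/eqP => /(congr1 tag) /= ee; rewrite ee eqxx in ne.
case: e' / ee j => j; rewrite andbT.
pose T := fun e => 'I_(npts s e); pose T' := fun e => 'I_(npts s (psiE e)).
rewrite -[LHS]/(Tagged T j2 == Tagged T j).
rewrite -[RHS]/(Tagged T' j2 == Tagged T' j).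
by rewrite !eq_Tagged.
Qed.

Lemma sub_cover_harmonic (x : vert (Gam Y)) (k : edge (GamT Y) * bool) :
  hstart k = psiV x ->
  (\sum_(h | (hstart h == x) && (psiH h == k)) degE h.1 = degV x)%N.
Proof.
rewrite big_mkcondr /=; case: x => [u|q] /= kx.
  rewrite (big_half_orig (s := sub_pull s)) -big_mkcondr /=.
  have kE := hstart_sub_inl kx; set k0 := (_, _) in kE.
  have k0u : hstart k0 = psiV u.
    by move: kx; rewrite kE hstart_sub_half => -[].
  rewrite -(harmonic hX k0u); apply: eq_big => [h|[e []]//].
  by rewrite kE psiH_sub_half (inj_eq (@sub_half_inj _ _)).
rewrite (big_half_new (s := sub_pull s)) /=; move/eqP: kx.
set q' := existT _ _ _; rewrite hstart_sub_inr.
have ab : (half_after q' == half_before q') = false by rewrite xpair_eqE andbF.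
have -> : psiH (X := Y) (half_after q) = half_after q' by [].
have -> : psiH (X := Y) (half_before q) = half_before q' by [].
case/orP=> /eqP->; first by rewrite eqxx eq_sym ab addn0.
by rewrite eqxx ab.
Qed.

Lemma sub_cover_double_cover : is_double_cover Y.
Proof.
have sum_orig (f : vert (Gam X) -> nat) :
    (\sum_(p in [set: vert (Gam Y)]) on_orig (s := s) f p =
     \sum_(u in setT) f u)%N.
  rewrite big_sumType /= [X in (_ + X)%N]big1 // addn0.
  by apply: eq_bigl => u; rewrite !inE.
have degE0 (e : edge (Gam X)) : (degE e)%:R != 0 :> R.
  by rewrite pnatr_eq0 -lt0n degE_gt0.
split.
- exact: (sub_graph_connected _ (Gam_connected hX)).
- by rewrite -(Gam_genus hX); apply: genus_sub_graph;
    [exact: Gam_connected|exact: sum_orig].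
- exact: (sub_graph_connected _ (GamT_connected hX)).
- have := genus_sub_graph (g := fun=> 0%N)
    (g' := fun _ : vert (sub_graph s) => 0%N) (GamT_connected hX).
  by rewrite /genus !big1 // !addn0 => ->; rewrite ?(GamT_tree hX).
- by move=> a; apply: psiV_sub_point.
- by move=> a; apply: psiV_sub_point.
- move=> [e i] /=; rewrite subr_gt0 ltr_pM2r ?invr_gt0 ?ltr0n ?degE_gt0 //.
  by apply: (cut_lt s_subdiv); rewrite -ltnS.
- move=> [e i] /=; rewrite subr_gt0; apply: (cut_lt s_subdiv); by rewrite -ltnS.
- by move=> [e i]; apply: (degE12 hX).
- by move=> [e i] /=; field.
- by move=> [u|q] /=; rewrite ?(degV_gt0 hX) ?degE_gt0.
- exact: sub_cover_degree2.
- exact: sub_cover_harmonic.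
- by move=> i; apply: (simply_ramified hX).
- case=> [u|q].
    rewrite (big_half_orig (s := sub_pull s)).
    rewrite (eq_bigr (fun h => (degE h.1).-1)) => [|[e []]//].
    have -> : ramdeg (X := Y) (inl u) = ramdeg u.
      by apply: eq_card => i; rewrite !inE.
    exact: (riemann_hurwitz hX).
  rewrite (big_half_new (s := sub_pull s)) /=.
  have -> : ramdeg (X := Y) (inr q) = 0%N by apply: eq_card0 => i; rewrite !inE.
  by have := degE_gt0 (tag q); move: (degE _) => d; lia.
Qed.

End SubdividedCover.

Lemma bigmax_dominated (R : realType) (I : finType) (F : I -> R) i :
  (forall j, F j <= F i) -> \big[Num.max/0]_j F j = Num.max 0 (F i).
Proof.
move=> Fi; apply/eqP; rewrite eq_le ge_max bigmax_ge_id le_bigmax !andbT.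
by apply: bigmax_le => [|j _]; rewrite le_max ?lexx // Fi orbT.
Qed.

(* [Num.max 0] is affine between [x] and [y] only if there is no kink. *)
Lemma max0_midpoint (R : realType) (x y : R) : x <= 0 -> 0 < y ->
  Num.max 0 ((x + y) / 2) = (Num.max 0 x + Num.max 0 y) / 2 -> x = 0.
Proof.
move=> x0 y0; rewrite (max_l x0) (max_r (ltW y0)) add0r.
have [m0|m0] := leP 0 ((x + y) / 2); lra.
Qed.

Lemma on_edge_le (R : realType) (G : mgraph R) (f g : vert G -> R) e t :
  0 < len e -> 0 <= t <= len e -> (forall u, f u <= g u) ->
  on_edge f e t <= on_edge g e t.
Proof.
move=> l0 /andP[t0 tl] fg; have := fg (src e); have := fg (tgt e).
rewrite /on_edge; set r := t / len e.
have r0 : 0 <= r by rewrite divr_ge0 // ltW.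
have r1 : r <= 1 by rewrite ler_pdivrMr // mul1r.
by move=> ft fs; nra.
Qed.

Section Admissible.
Variables (R : realType) (X : double_cover R) (s : subdiv (GamT X)).
Hypothesis hX : is_double_cover X.
Hypothesis s_subdiv : is_subdiv s.
Notation Y := (sub_cover s).

Lemma admissible_sub_ext v0 (f : vert (GamT X) -> R) :
  is_admissible v0 f -> @admissible_at R Y (inl v0) (sub_ext (s := s) f).
Proof.
case=> _ div_f [u|q]; rewrite /D' branchdeg_in_setT.
  rewrite val_in_orig (div_sub_ext_orig s_subdiv (lenT_gt0 hX)).
  have -> : @branchdeg R Y (inl u) = branchdeg_in [set: vert (GamT X)] u.
    by rewrite branchdeg_in_setT; apply: eq_card => i; rewrite !inE.
  exact: div_f.
rewrite val_in_new (div_sub_ext_new s_subdiv (lenT_gt0 hX)).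
have -> : @branchdeg R Y (inr q) = 0%N by apply: eq_card0 => i; rewrite !inE.
by rewrite mul0r !addr0 subrr.
Qed.

Lemma lambda_subE (lam : vert (GamT X) -> vert (GamT X) -> R) p :
  lambda_sub (s := s) lam p = \big[Num.max/0]_v0 sub_ext (s := s) (lam v0) p.
Proof. by case: p. Qed.

Lemma normalized_zero (f : vert (GamT X) -> R) : is_normalized f ->
  exists w, [/\ (0 < wtT w)%N, f w = 0
    & forall g, is_normalized g -> g w <= 0].
Proof.
move=> nf; have := nneg_wt nf; rewrite lt0n => /eqP.
case: (pickP (fun x => (0 <= f (psiV x)) && (0 < wt x)%N)) => [x|no]; last first.
  case; apply: big1 => x fx; have := no x.
  by rewrite fx /= lt0n => /negbFE/eqP.
move=> /andP[fx wx] _.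
have le0 g : is_normalized g -> g (psiV x) <= 0.
  by move=> ng; rewrite leNgt; apply/negP => /(pos_wt0 ng) wx0; rewrite wx0 in wx.
exists (psiV x); split=> //; last by apply/eqP; rewrite eq_le fx le0.
by rewrite /wtT (bigD1 x) //= addn_gt0 wx.
Qed.

End Admissible.

Lemma cut_le (R : realType) (G : mgraph R) (s : subdiv G) e i j :
  is_subdiv s -> (i <= j <= (npts s e).+1)%N -> cut s e i <= cut s e j.
Proof.
move=> hs /andP[]; elim: j => [|j IH]; first by rewrite leqn0 => /eqP ->.
rewrite leq_eqVlt => /orP[/eqP->//|ij] lej.
by apply: (le_trans (IH ij (ltnW lej))); apply/ltW/(cut_lt hs).
Qed.

Theorem lemma3p24 (R : realType) (X : double_cover R)
    (lam : vert (GamT X) -> vert (GamT X) -> R)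
    (s : subdiv (GamT X)) (Delta : {set vert (Gam (sub_cover s))})
    (v : vert (GamT (sub_cover s))) :
  let Y := sub_cover s in
  let lamT := lambda_sub (s := s) lam in
  is_weighted_cover X ->
  (forall v0, is_admissible v0 (lam v0) /\ is_normalized (lam v0)) ->
  is_subdiv s -> adapted s lam ->
  is_Delta lamT Delta ->
  subcurve_connected (pos_locus lamT) ->
  genus (@vgen R Y) (pos_locus lamT) = 2%N ->
  [set p in boundaryT lamT | (0 < wtT p)%N] = [set v] ->
  special lamT (@psiV R Y @: Delta) = [set v].
Proof.
move=> Y lamT [hX _ _] hlam hs hadapted hDelta.
have hY : is_double_cover Y := sub_cover_double_cover hX hs.
pose U := pos_locusT lamT.
have -> : pos_locus lamT = @psiV R Y @^-1: U by apply/setP => x; rewrite !inE.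
move=> cU gU hv.
pose F v0 : vert (GamT Y) -> R := sub_ext (s := s) (lam v0).
have admF v0 : @admissible_at R Y (inl v0) (F v0).
  by apply: admissible_sub_ext => //; case: (hlam v0).
have F_le v0 p : F v0 p <= lamT p.
  by rewrite /lamT lambda_subE; exact: (le_bigmax _ (fun v0 => F v0 p)).
have outU p : p \notin U -> lamT p <= 0 by rewrite inE -leNgt.
have F_le0 v0 p : p \notin U -> F v0 p <= 0.
  by move=> /outU; apply: le_trans.
(* Every admissible function vanishes at [v], as they all decrease strictly
   away from [U], so that their maximum over the weighted vertices is attained
   on the boundary of [U]. *)
have Fv v0 : F v0 v = 0 /\ exists w, v = inl w.
  have [w [ww fw lew]] := normalized_zero (proj2 (hlam v0)).
  have wU : (inl w : vert (GamT Y)) \notin U.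
    rewrite inE -leNgt /lamT lambda_subE; apply: bigmax_le => // v1 _.
    exact: lew (proj2 (hlam v1)).
  suff wv : inl w = v by rewrite -wv; split=> //; exists w.
  apply/eqP; rewrite -in_set1 -hv in_set; apply/andP; split; last first.
    move: ww; rewrite /wtT big_sumType /= addn_gt0 => ww.
    by rewrite (eq_bigl (fun x => psiV x == w)) ?ww.
  rewrite in_setD wU; apply/negPn/negP => wK.
  have := admissible_lt0 hY cU gU (admF v0) (F_le0 v0) wK.
  by rewrite /F /= fw ltxx.
have [w vw] : exists w, v = inl w.
  have [x _] := connected_neq0 (GamT_connected hX).
  by have [] := Fv x.
have Fw v0 p : F v0 p <= F w p.
  rewrite -subr_ge0; pose g q := F w q - F v0 q.
  have <- : g v = 0 by rewrite /g !(proj1 (Fv _)) subrr.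
  apply: (min_principle (f := g) (GamT_connected hY) (lenT_gt0 hY)) => q qv.
  have -> : div_in setT g q = div_in setT (F w) q - div_in setT (F v0) q.
    by rewrite /div_in -sumrB; apply: eq_bigr => h _; rewrite /slope /g; ring.
  have := admF w q; have := admF v0 q; rewrite -vw (negbTE qv).
  by case: (q == _) => /=; lra.
have lamTE p : lamT p = Num.max 0 (F w p).
  by rewrite /lamT lambda_subE; apply: bigmax_dominated => v0; apply: Fw.
have lam_edgeE e t : 0 <= t <= len e ->
    lambda_edge lam e t = Num.max 0 (on_edge (lam w) e t).
  move=> te; apply: bigmax_dominated => v0; apply: on_edge_le => // [|u].
    exact: (lenT_gt0 hX).
  exact: (Fw v0 (inl u)).
have Fbd : {in closure_of U, lamT =1 F w}.
  move=> p pK; have [pU|pU] := boolP (p \in U).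
    by move: (pU); rewrite inE lamTE; case: (leP 0 (F w p)) => // _; rewrite ltxx.
  have Fp : F w p <= 0 := F_le0 w p pU.
  rewrite lamTE max_l //; apply/esym.
  have [[[e i] b] [hp hU]] := closure_ofP pK pU.
  have lti := ltn_ord i; rewrite ltnS in lti.
  pose c := cut s e i; pose c' := cut s e i.+1.
  have cc : c < c' := cut_lt hs lti.
  have F0 : F w (sub_point s e i) = on_edge (lam w) e c.
    by rewrite /F (sub_ext_point hs (lenT_gt0 hX)) // leqW.
  have F1 : F w (sub_point s e i.+1) = on_edge (lam w) e c'.
    by rewrite /F (sub_ext_point hs (lenT_gt0 hX)) // ltnS.
  have onm : on_edge (lam w) e ((c + c') / 2) =
      (on_edge (lam w) e c + on_edge (lam w) e c') / 2.
    by rewrite /on_edge; field; rewrite gt_eqF ?(lenT_gt0 hX).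
  have c0 : 0 <= c by rewrite -(cut_first hs e) cut_le // leqW.
  have cl : c' <= len e by rewrite -(cut_last hs e) cut_le // ltnS lti leqnn.
  have [a [a' lin]] := hadapted e i lti.
  have lin_at t : c <= t <= c' -> Num.max 0 (on_edge (lam w) e t) = a + a' * t.
    move=> /[dup] /lin <- /andP[ct tc]; rewrite lam_edgeE //.
    by rewrite (le_trans c0 ct) (le_trans tc cl).
  have mid : Num.max 0 ((on_edge (lam w) e c + on_edge (lam w) e c') / 2) =
      (Num.max 0 (on_edge (lam w) e c) + Num.max 0 (on_edge (lam w) e c')) / 2.
    by rewrite -onm !lin_at; lra.
  have F_gt0 q : q \in U -> 0 < F w q.
    by rewrite inE lamTE; case: (leP 0 (F w q)) => [le0|_]; rewrite ?ltxx.
  move: Fp (F_gt0 _ hU); rewrite -hp /hstart /hend /=.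
  case: b {hp hU} => /=; rewrite F0 F1 => le0 gt0.
    by apply: (max0_midpoint le0 gt0); rewrite addrC mid addrC.
  exact: (max0_midpoint le0 gt0).
rewrite (is_Delta_closure hY cU gU (erefl U) hDelta).
apply: (special_boundary hY cU gU _ _ Fbd); last by rewrite vw; apply: admF.
by have := set11 v; rewrite -hv inE => /andP[].
Qed.
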